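(* For each integer $m \geq 2$, \[ L(m) \geq \frac{s^2 + (2m-1)s - 1 + \sqrt{(s^2-s-1)^2 + 4m(s-1)(s^2 + s + 1 - m)}}{2 m (s^2+s-1)}, \] where $s$ is the positive integer such that $s^2-s+1 < m \leq s^2+s+1$. Furthermore, if equality holds, then $m=4$ or $m \in \{s^2+s,s^2+s+1\}$.
   Context: A covering design is a pair $(X,\mathcal{B})$ with $X$ a finite set of points and $\mathcal{B}$ a finite multiset of subsets of $X$ (blocks) such that every pair of distinct points lies together in at least one block. A weighting of a finite set $S$ assigns nonnegative reals to its elements; $w(S')=\sum_{x\in S'}w(x)$; $w$ is normalised if $w(S)=1$. For a covering design $D=(X,\mathcal{B})$ and normalised weighting $w$ of $X$, $L(D,w)=\max\{w(B):B\in\mathcal{B}\}$; $L(D)$ is the infimum of $L(D,w)$ over normalised weightings $w$ of $X$; $L(m)$ is the infimum of $L(D)$ over all covering designs $D$ with exactly $m$ blocks (counted with multiplicity).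
   Formalization: The inequality is asserted for m ≠ 3 only (at m = 3, s = 1 the right side is 1 while L(3) ≤ 2/3), and covering designs are required to have at least two points, since one point with m empty blocks would make L(m) = 0. *)

(* Defs.v *)
From HB Require Import structures.
From mathcomp Require Import all_boot all_order all_algebra.
From mathcomp Require Import finmap multiset.
From mathcomp Require Import all_classical all_reals.

Set Implicit Arguments.
Unset Strict Implicit.
Unset Printing Implicit Defensive.

Import Order.TTheory GRing.Theory Num.Theory.

Local Open Scope classical_set_scope.
Local Open Scope ring_scope.

(* Designs have at least two points. On a single point the covering condition
   is vacuous, so m empty blocks would give the value 0; on no points there is
   no normalised weighting. *)
Record covering_design := CoveringDesign {
  points : finType;
  blocks : {mset {set points}}%mset;
  points_gt1 : (1 < #|points|)%N;
  pair_covered : forall x y : points, x <> y ->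
    exists2 B, B \in blocks & x \in B /\ y \in B }.

Definition weighting (R : realType) (T : finType) (w : T -> R) : Prop :=
  forall x, 0 <= w x.

Definition weight (R : realType) (T : finType) (w : T -> R) (A : {set T}) : R :=
  \sum_(x in A) w x.

Definition normalised (R : realType) (T : finType) (w : T -> R) : Prop :=
  weighting w /\ weight w [set: T]%SET = 1.

(* The default value 0 of the maximum is harmless: weights of blocks are
   nonnegative, and only designs with at least one block matter. *)
Definition L_weighted (R : realType) (D : covering_design)
    (w : points D -> R) : R :=
  \big[Num.max/0]_(B <- blocks D) weight w B.

(* Both infima are over sets bounded below by 0; the first set is never empty,
   the second is nonempty for every m >= 1, so inf is a genuine infimum. *)
Definition L_design (R : realType) (D : covering_design) : R :=
  inf [set L_weighted w | w in @normalised R (points D)].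

Definition L_num (R : realType) (m : nat) : R :=
  inf [set l | exists2 D : covering_design, size (blocks D) = m & l = L_design R D].

(* Main.v *)
(** Fix a weighting with all block weights at most L, and let r x be the number
of blocks on x. A basic solution of the linear program has support of size at
most m, so one may assume that there are m points. The blocks on x cover every
point, and x itself r x times, hence 1 + (r x - 1) w x <= r x L; moreover the
sum of r x * w x is at most m L. If s L < 1 then every r x exceeds s and
m L >= s + 1. If s L > 1, then 1 >= w x (r x - 1) / (r x L - 1); the function
(r - 1) / (r L - 1) is convex, so it may be replaced by its chord through r = s
and r = s + 1. Summing over the m points gives a quadratic inequality in L
whose larger root is the bound.

In the equality case any two points lie in exactly one block, there are as many
points as blocks, and all degrees are s or s + 1. By de Bruijn-Erdos the point
degree equals the block size for non-incident pairs, which forces m = 2s or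
m = d^2 - d + 1 with d = s or s + 1; in the range considered only m = 4
survives. Finally, L(m) is a minimum: there are finitely many incidence
relations on m points and m blocks, and for each one the minimum over the
simplex is attained. *)

Require Import Defs.
From mathcomp Require Import all_boot all_order all_algebra.
From mathcomp Require Import zify ring lra.
From mathcomp Require Import finmap multiset.
From mathcomp Require Import all_classical all_reals.
From mathcomp Require Import topology normedtype derive.
Set Implicit Arguments.
Unset Strict Implicit.
Unset Printing Implicit Defensive.
Import Order.TTheory GRing.Theory Num.Theory.
Import numFieldTopology.Exports numFieldNormedType.Exports.
Local Open Scope ring_scope.

(* [inc x j] means that the point x lies in the block j. *)
Definition feasible (R : realFieldType) (T : finType) (m : nat)
    (inc : T -> 'I_m -> bool) (w : T -> R) (L : R) : Prop :=
  [/\ forall x, 0 <= w x, \sum_x w x = 1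
    & forall j, \sum_(x | inc x j) w x <= L].

(** * Reduction to as many points as blocks *)

Section SupportReduction.
Context (R : realFieldType) (m : nat) (T : Type) (inc : T -> 'I_m -> bool).
Variable L : R.
Hypothesis inc_ex : forall x, exists j, inc x j.

(** [f] need not be injective: repeated points allow any large enough number of indices, even when
    there are fewer points than blocks. *)
Definition feasible_on (n : nat) : Prop :=
  exists (f : 'I_n -> T) (w : 'I_n -> R), feasible (inc \o f) w L.

Lemma feasible_on_widen n : feasible_on n -> feasible_on n.+1.
Proof.
case=> f [w [w0 w1 wL]].
have n0 : (0 < n)%N.
  case: n f w w0 w1 wL => // f w _; rewrite big_ord0 => /eqP.
  by rewrite eq_sym oner_eq0.
(* The new index repeats an old point with weight 0. *)
exists (fun i => oapp f (f (Ordinal n0)) (unlift ord0 i)).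
exists (fun i => oapp w 0 (unlift ord0 i)); split.
- by move=> i; case: unliftP => [k|] _ /=.
- rewrite big_ord_recl unlift_none /= add0r.
  by under eq_bigr do rewrite liftK /=.
- move=> j; rewrite big_mkcond big_ord_recl /= unlift_none /= if_same add0r.
  under eq_bigr do rewrite liftK /=.
  by rewrite -big_mkcond; exact: wL.
Qed.

(** With more points than blocks the rows of the incidence matrix are dependent; the sign of the
    relation is chosen to make its total nonnegative. *)
Lemma linear_dependence n (f : 'I_n -> T) : (m < n)%N ->
  exists z : 'I_n -> R, [/\ 0 <= \sum_i z i, exists i, z i != 0
    & forall j, \sum_(i | inc (f i) j) z i = 0].
Proof.
move=> mn; pose N : 'M[R]_(n, m) := \matrix_(i, j) (inc (f i) j)%:R.
have kN : kermx N != 0.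
  rewrite kermx_eq0 /row_free; apply/negP => /eqP rN.
  by have := rank_leq_col N; rewrite rN leqNgt mn.
have [i ri] : exists i, row i (kermx N) != 0.
  apply/existsP; apply: contraR kN => /existsPn h.
  by apply/eqP/row_matrixP => i; rewrite row0; apply/eqP; rewrite -[_ == _]negbK.
pose v := row i (kermx N).
have vN : v *m N = 0 by rewrite -row_mul mulmx_ker row0.
have vN' j : \sum_(k | inc (f k) j) v 0 k = 0.
  have := congr1 (fun A : 'rV_m => A 0 j) vN; rewrite !mxE => {2}<-.
  rewrite big_mkcond; apply: eq_bigr => k _; rewrite [N _ _]mxE.
  by case: ifP; rewrite ?mulr1 ?mulr0.
have [k vk] : exists k, v 0 k != 0.
  by move/rV0Pn: ri.
have [s0|s0] := leP 0 (\sum_k v 0 k).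
  by exists (v 0); split => //; exists k.
exists (fun k => - v 0 k); split.
- by rewrite sumrN oppr_ge0 ltW.
- by exists k; rewrite oppr_eq0.
- by move=> j; rewrite sumrN vN' oppr0.
Qed.

(** Moving [w] along a relation [z] keeps all block loads and does not lower the total. Stop when
    some weight vanishes, delete that index and rescale, which does not raise the loads. *)
Lemma feasible_on_drop n : (m <= n)%N -> feasible_on n.+1 -> feasible_on n.
Proof.
move=> mn [f [w [w0 w1 wL]]].
have [z [z0 [i0 zi0] zN]] := linear_dependence (n := n.+1) f mn.
(* A nonnegative [z] would vanish on every block, hence at [i0], which lies on one. *)
have [i1 zi1] : exists i, z i < 0.
  apply/existsP; apply: contraR zi0 => /existsPn zge.
  have {}zge i : 0 <= z i by rewrite leNgt.
  have [j fj] := inc_ex (f i0).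
  by apply/eqP; apply: (psumr_eq0P (fun i _ => zge i) (zN j)).
(* Ratio test: [t] is the longest step keeping all weights nonnegative. *)
have [i zi tmin] := @arg_minP _ _ _ i1 (fun i => z i < 0)
  (fun i => w i / - z i) zi1.
set t := w i / - z i in tmin.
have t0 : 0 <= t by rewrite divr_ge0 // oppr_ge0 ltW.
pose u k := w k + t * z k.
have u0 k : 0 <= u k.
  have [zk|zk] := leP 0 (z k); first by rewrite addr_ge0 // mulr_ge0.
  have := tmin k zk; rewrite /u ler_pdivlMr ?oppr_gt0 //; lra.
have ui : u i = 0 by rewrite /u /t; field; rewrite lt_eqF.
have su : \sum_k u k = 1 + t * \sum_k z k by rewrite big_split /= w1 mulr_sumr.
have su1 : 1 <= \sum_k u k by rewrite su lerDl mulr_ge0.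
have su0 : 0 < \sum_k u k by apply: lt_le_trans su1.
have dropi (P : pred 'I_n.+1) : \sum_(k < n | P (lift i k)) u (lift i k) =
    \sum_(k | P k) u k.
  rewrite [RHS]big_mkcond (bigD1_ord i) //= ui if_same add0r.
  by rewrite -big_mkcond.
exists (f \o lift i), (fun k => u (lift i k) / \sum_k u k); split.
- by move=> k; rewrite divr_ge0 // ltW.
- by rewrite -mulr_suml (dropi xpredT) mulfV ?gt_eqF.
- move=> j; rewrite -mulr_suml (dropi (fun k => inc (f k) j)).
  have -> : \sum_(k | inc (f k) j) u k = \sum_(k | inc (f k) j) w k.
    by rewrite big_split /= -mulr_sumr zN mulr0 addr0.
  apply: le_trans (wL j); rewrite ler_pdivrMr // ler_peMr //.
  by apply: sumr_ge0.
Qed.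

Lemma feasible_on_blocks n : feasible_on n -> feasible_on m.
Proof.
have up k : feasible_on k -> feasible_on (k + (m - k)).
  by elim: (m - k)%N => [|d IH]; rewrite ?addn0 // addnS => /IH/feasible_on_widen.
have [nm|mn] := leqP n m; first by move/up; rewrite subnKC.
rewrite -(subnKC (ltnW mn)); elim: (n - m)%N => [|d IH]; rewrite ?addn0 //.
by rewrite addnS => /feasible_on_drop h; apply: IH; apply: h; rewrite leq_addr.
Qed.

End SupportReduction.

(** * Linear spaces with equally many points and blocks *)

Section DeBruijnErdos.
Context (m : nat) (inc : 'I_m -> 'I_m -> bool).

Definition deg x := #|[pred j | inc x j]|.
Definition joint x y := #|[pred j | inc x j && inc y j]|.
Definition bsize j := #|[pred x | inc x j]|.

Lemma jointxx x : joint x x = deg x.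
Proof. by apply: eq_card => j; rewrite !inE andbb. Qed.

Hypothesis joint1 : forall x y, x != y -> joint x y = 1%N.
Hypothesis bsize_lt : forall j, (bsize j < m)%N.
Hypothesis deg_lt : forall x, (deg x < m)%N.

Lemma sum_bsize_joint x (P : pred 'I_m) :
  (\sum_(j | inc x j) #|[pred y | inc y j && P y]| = \sum_(y | P y) joint x y)%N.
Proof.
rewrite /joint; under eq_bigr do rewrite -sum1_card.
under [RHS]eq_bigr do rewrite -sum1_card.
rewrite (exchange_big_dep P) /=; last by move=> i j _ /andP[].
apply: eq_bigr => y Py; apply: eq_bigl => j.
by rewrite !inE Py andbT.
Qed.

(** Each point of [j] is joined to [x] by a block, and these blocks are distinct: two points of [j]
    on one of them would share two blocks. *)
Lemma bsize_le_deg x j : ~~ inc x j -> (bsize j <= deg x)%N.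
Proof.
move=> xj; rewrite /bsize -sum1_card.
have -> : (\sum_(y in [pred y | inc y j]) 1 = \sum_(y | inc y j) joint x y)%N.
  apply: eq_bigr => y; rewrite !inE => yj; rewrite joint1 //.
  by apply: contraNneq xj => ->.
rewrite -sum_bsize_joint /deg -sum1_card.
apply: leq_sum => i xi; rewrite leqNgt; apply/negP => /card_gt1P[y [y' []]].
rewrite !inE => /andP[yi yj] /andP[y'i y'j] yy'.
suff : (1 < joint y y')%N by rewrite joint1.
apply/card_gt1P; exists i, j; rewrite !inE yi yj y'i y'j; split => //.
by apply: contraNneq xj => <-.
Qed.

(* Conway's double counting: both sides of [bsize_le_deg], summed with weights
   1 / (m - _) over the non-incident pairs, give m. *)
Lemma bsize_eq_deg x j : ~~ inc x j -> bsize j = deg x.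
Proof.
move=> xj.
have mV (k : nat) : (k < m)%N -> 0 < (m - k)%:R :> rat by rewrite ltr0n subn_gt0.
have cardC (P : pred 'I_m) : (#|[pred i | ~~ P i]| = m - #|[pred i | P i]|)%N.
  have := cardC [pred i | P i]; rewrite card_ord.
  rewrite (_ : #|[predC _]| = #|[pred i | ~~ P i]|); last exact: eq_card.
  by move/(canRL (addKn _)).
pose F x j : rat := (m - deg x)%:R^-1 - (m - bsize j)%:R^-1.
have F0 y i : ~~ inc y i -> 0 <= F y i.
  move=> yi; rewrite subr_ge0 lef_pV2 ?posrE ?mV //.
  by rewrite ler_nat leq_sub2l // bsize_le_deg.
have sF : \sum_y \sum_(i | ~~ inc y i) F y i = 0.
  rewrite /F; under eq_bigr do rewrite big_split /=.
  rewrite big_split /= [X in _ + X](exchange_big_dep xpredT) //=.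
  rewrite (_ : \sum_(_ < _) _ = m%:R); last first.
    rewrite -[in RHS](card_ord m) -sumr_const; apply: eq_bigr => y _.
    rewrite sumr_const (eq_card (B := [pred i | ~~ inc y i])) // cardC.
    by rewrite -[LHS]mulr_natr mulVf // gt_eqF // mV.
  rewrite (_ : \sum_(_ < _) _ = - m%:R) ?subrr //.
  rewrite -[in RHS](card_ord m) -sumr_const -sumrN; apply: eq_bigr => i _.
  rewrite sumr_const (eq_card (B := [pred y | ~~ inc y i])) // cardC.
  by rewrite mulNrn -[X in - X = _]mulr_natr mulVf // gt_eqF // mV.
have sFx : \sum_(i | ~~ inc x i) F x i = 0.
  apply: (psumr_eq0P _ sF) => // y _.
  by apply: sumr_ge0 => i; exact: F0.
have /eqP := psumr_eq0P (F0 x) sFx xj.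
rewrite subr_eq0 (inj_eq invr_inj) eqr_nat => /eqP.
by have := bsize_lt j; have := deg_lt x; lia.
Qed.

(** If all degrees are [d], so are all block sizes, and counting along the blocks on one point gives
    d^2 = d + m - 1. If both degrees occur, at [x] and [y], every block meets {x, y} and exactly one
    contains it, so m = (s + 1) + s - 1. *)
Lemma linear_space_card s : (0 < m)%N ->
  (forall x, deg x = s \/ deg x = s.+1) ->
  [\/ m = s.*2, (m + s = s ^ 2 + 1)%N | m = (s ^ 2 + s + 1)%N].
Proof.
move=> m0 hd.
have reg d : (forall x, deg x = d) -> (m + d = d ^ 2 + 1)%N.
  move=> hdd; have x : 'I_m by exists 0%N.
  have bs j : bsize j = d.
    have /existsP[y yj] : [exists y, ~~ inc y j].
      apply: contraTT (bsize_lt j) => /existsPn h; rewrite -leqNgt.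
      rewrite -[X in (X <= _)%N](card_ord m) subset_leq_card //.
      by apply/fintype.subsetP => y _; rewrite !inE -[inc _ _]negbK.
    by rewrite (bsize_eq_deg yj).
  have := sum_bsize_joint x xpredT.
  rewrite [in RHS](bigD1 x) //= jointxx (eq_bigr (fun=> d)); last first.
    by move=> j _; rewrite -(bs j); apply: eq_card => y; rewrite !inE andbT.
  rewrite [in RHS](eq_bigr (fun=> 1%N)) //; last first.
    by move=> y; rewrite eq_sym; exact: joint1.
  rewrite !sum_nat_const muln1 cardC1 card_ord hdd.
  rewrite (_ : #|_| = d); last by rewrite -(hdd x); apply: eq_card.
  by rewrite -mulnn; lia.
have [/forallP h|/forallPn[x xs]] := boolP [forall x, deg x == s].
  by apply: Or32; apply: reg => x; apply/eqP.
have [/forallP h|/forallPn[y ys]] := boolP [forall x, deg x == s.+1].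
  apply: Or33; have : (m + s.+1 = s.+1 ^ 2 + 1)%N by apply: reg => y; apply/eqP.
  by rewrite -!mulnn; lia.
apply: Or31.
have dx : deg x = s.+1 by case: (hd x) xs => ->; rewrite ?eqxx.
have dy : deg y = s by case: (hd y) ys => ->; rewrite ?eqxx.
have xy : x != y by apply: contra_eq_neq dx => ->; rewrite dy; lia.
(* A block missing both points would have size [s] and [s.+1] at once. *)
have cU : #|[predU [pred j | inc x j] & [pred j | inc y j]]| = m.
  rewrite -[RHS](card_ord m); apply: eq_card => j; rewrite !inE.
  apply/negbNE/negP; rewrite negb_or => /andP[xj yj].
  by have := bsize_eq_deg xj; rewrite (bsize_eq_deg yj) dx dy; lia.
have := cardUI [pred j | inc x j] [pred j | inc y j].
rewrite cU -/(deg x) -/(deg y) dx dy (_ : #|[predI _ & _]| = 1%N); first by lia.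
by rewrite -(joint1 xy); apply: eq_card => j; rewrite !inE.
Qed.

End DeBruijnErdos.

(** * Point degrees and block loads *)

Section Degrees.
Context (R : realFieldType) (m : nat) (inc : 'I_m -> 'I_m -> bool).
Variables (w : 'I_m -> R) (L : R).
Hypothesis wL : feasible inc w L.
Hypothesis joint_gt0 : forall x y, (0 < joint inc x y)%N.

Lemma sum_deg_le : \sum_x (deg inc x)%:R * w x <= m%:R * L.
Proof.
have [w0 _ bL] := wL.
have -> : m%:R * L = \sum_(j < m) L by rewrite sumr_const card_ord mulr_natl.
apply: le_trans (ler_sum _ (fun j _ => bL j)).
rewrite (exchange_big_dep xpredT) //=; apply: ler_sum => x _.
by rewrite sumr_const mulr_natl.
Qed.

(** Adds the loads of the blocks on [x] and splits off the total weight 1. The last sum, the excess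
    from points sharing several blocks with [x], is kept for the equality case. *)
Lemma deg_load x : 1 + ((deg inc x)%:R - 1) * w x
    + \sum_(y | y != x) ((joint inc x y)%:R - 1) * w y <= (deg inc x)%:R * L.
Proof.
have [w0 w1 bL] := wL.
have -> : (deg inc x)%:R * L = \sum_(j | inc x j) L by rewrite sumr_const mulr_natl.
apply: le_trans (ler_sum _ (fun j _ => bL j)).
rewrite (exchange_big_dep xpredT) //=.
rewrite -jointxx -addrA -(bigD1 x (P := xpredT)
  (F := fun y => ((joint inc x y)%:R - 1) * w y)) //=.
rewrite -[X in X + _]w1 -big_split /=; apply: ler_sum => y _.
by rewrite sumr_const mulrBl mul1r addrC subrK mulr_natl.
Qed.

Lemma deg_point x : ((deg inc x)%:R - 1) * w x <= (deg inc x)%:R * L - 1.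
Proof.
have [w0 _ _] := wL; have := deg_load x.
have : 0 <= \sum_(y | y != x) ((joint inc x y)%:R - 1) * w y.
  apply: sumr_ge0 => y _; rewrite mulr_ge0 // subr_ge0 ler1n.
  exact: joint_gt0.
lra.
Qed.

Lemma deg_gt0 x : (0 < deg inc x)%N.
Proof. by rewrite -jointxx. Qed.

Lemma deg_gt_load s : (forall x, w x != 0 -> (s < deg inc x)%N) ->
  s.+1%:R <= m%:R * L.
Proof.
have [w0 w1 _] := wL.
move=> h; apply: le_trans sum_deg_le.
have -> : s.+1%:R = \sum_x s.+1%:R * w x by rewrite -mulr_sumr w1 mulr1.
apply: ler_sum => x _; have [->|wx] := eqVneq (w x) 0; first by rewrite !mulr0.
by apply: ler_wpM2r => //; rewrite ler_nat h.
Qed.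

(** A degree at most [s] would make the right side of [deg_point] negative. *)
Lemma load_small s : s%:R * L < 1 -> s.+1%:R <= m%:R * L.
Proof.
have [w0 _ _] := wL.
move=> sL; apply: deg_gt_load => x _; rewrite ltnNge; apply/negP => ds.
have d1 : 1 <= (deg inc x)%:R :> R by rewrite ler1n deg_gt0.
have d2 : (deg inc x)%:R <= s%:R :> R by rewrite ler_nat.
have dw : 0 <= ((deg inc x)%:R - 1) * w x by rewrite mulr_ge0 // subr_ge0.
have := deg_point x; have [L0|L0] := leP 0 L; last by nra.
have := ler_wpM2r L0 d2; lra.
Qed.

(** When s L = 1, a degree between 2 and [s] only forces weight 0, so degrees are bounded on the
    support alone. Degree 1 would give L >= 1. *)
Lemma load_le1 s : (1 < s)%N -> s%:R * L <= 1 -> s.+1%:R <= m%:R * L.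
Proof.
have [w0 _ _] := wL.
move=> s1 sL; apply: deg_gt_load => x wx; rewrite ltnNge; apply/negP => ds.
have wx0 : 0 < w x by rewrite lt_def wx w0.
have d2 : (deg inc x)%:R <= s%:R :> R by rewrite ler_nat.
have s2 : 2 <= s%:R :> R by rewrite ler_nat.
have := deg_point x; have := deg_gt0 x; rewrite leq_eqVlt => /orP[/eqP<-|d1].
  by rewrite subrr mul0r; nra.
have {}d1 : 2 <= (deg inc x)%:R :> R by rewrite ler_nat.
have dw : 0 < ((deg inc x)%:R - 1) * w x by rewrite mulr_gt0 // subr_gt0; lra.
have [L0|L0] := leP 0 L; last by nra.
have := ler_wpM2r L0 d2; lra.
Qed.

End Degrees.

(* The chord through r = s and r = s + 1 of the convex function
   (r - 1) / (r L - 1), with denominators cleared. *)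
Lemma chord_bound (R : realFieldType) (r s : nat) (w L : R) :
  0 < L < 1 -> 1 < s%:R * L -> (1 < r)%N -> 0 <= w ->
  (r%:R - 1) * w <= r%:R * L - 1 ->
  let c := (s%:R - 1) * (s.+1%:R * L - 1) - (r%:R - s%:R) * (1 - L) in
  let d := (s%:R * L - 1) * (s.+1%:R * L - 1) in
  w * c <= d /\ (w * c = d ->
    [/\ 0 < w, r = s \/ r = s.+1 & (r%:R - 1) * w = r%:R * L - 1]).
Proof.
move=> /andP[L0 L1] sL r1 w0 rw c d.
(* A product of two consecutive integers. *)
have k0 : 0 <= (r%:R - s%:R) * (r%:R - s%:R - 1) :> R.
  have [rs|rs] := leqP r s.
    have : r%:R <= s%:R :> R by rewrite ler_nat.
    nra.
  have : s%:R + 1 <= r%:R :> R by rewrite natr1 ler_nat.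
  nra.
have LL : 0 < L * (1 - L) by rewrite mulr_gt0 // subr_gt0.
have S1 : s.+1%:R = s%:R + 1 :> R by rewrite natr1.
have d0 : 0 < d by rewrite /d S1; apply: mulr_gt0; lra.
have {}r1 : 0 < r%:R - 1 :> R by rewrite subr_gt0 ltr1n.
(* The gap between function and chord, zero only at r = s and r = s + 1. *)
have E : d * (r%:R - 1) - (r%:R * L - 1) * c
    = (r%:R - s%:R) * (r%:R - s%:R - 1) * (L * (1 - L)).
  by rewrite /d /c S1; ring.
have E0 : (r%:R * L - 1) * c <= d * (r%:R - 1).
  by rewrite -subr_ge0 E mulr_ge0 // ltW.
have [c0|c0] := leP c 0.
  have wc : w * c <= 0 by rewrite mulr_ge0_le0.
  by split; [exact: le_trans wc (ltW d0)|move=> wcd; lra].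
have wcr : (r%:R - 1) * w * c <= (r%:R * L - 1) * c by rewrite ler_wpM2r // ltW.
split.
  by rewrite -(ler_pM2r r1); lra.
move=> wcd; have dE : d * (r%:R - 1) = (r%:R - 1) * w * c by rewrite -wcd; ring.
have rE : (r%:R - 1) * w * c = (r%:R * L - 1) * c.
  by apply/eqP; rewrite eq_le wcr -dE E0.
split.
- by rewrite lt_def w0 andbT; apply: contra_eq_neq wcd => ->; rewrite mul0r lt_eqF.
- have /eqP : (r%:R - s%:R) * (r%:R - s%:R - 1) * (L * (1 - L)) = 0.
    by rewrite -E dE rE subrr.
  rewrite mulf_eq0 (gt_eqF LL) orbF mulf_eq0 !subr_eq0 subr_eq addrC natr1 !eqr_nat.
  by case/orP => /eqP ->; [left|right].
- by apply: (mulIf (lt0r_neq0 c0)).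
Qed.

(** * The quadratic inequality for the load *)

Definition load_poly (R : realFieldType) (m s : nat) (L : R) : R :=
  let t := s%:R ^+ 2 + s%:R - 1 in
  m%:R * t * L ^+ 2 - (t + 2 * (m%:R - 1) * s%:R) * L + (m%:R - 1).

Section Quadratic.
Context (R : realFieldType) (m s : nat) (inc : 'I_m -> 'I_m -> bool).
Variables (w : 'I_m -> R) (L : R).
Hypothesis wL : feasible inc w L.
Hypothesis joint_gt0 : forall x y, (0 < joint inc x y)%N.
Hypotheses (s_gt1 : (1 < s)%N) (m_lt : (m < s ^ 2 + s)%N).

(** Otherwise [load_le1] gives s (s + 1) <= m s L <= m. *)
Lemma load_gt_inv : 1 < s%:R * L.
Proof.
rewrite ltNge; apply/negP => sL.
have := load_le1 wL joint_gt0 s_gt1 sL.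
have : m%:R + 1 <= s%:R * (s%:R + 1) :> R.
  by rewrite !natr1 -natrM ler_nat; move: m_lt; rewrite -mulnn; lia.
have : 2 <= s%:R :> R by rewrite ler_nat.
rewrite -natr1.
have m0 : 0 <= m%:R :> R by rewrite ler0n.
nra.
Qed.

Hypothesis L_lt1 : L < 1.

Let L_gt0 : 0 < L.
Proof.
have := load_gt_inv; have : 0 < s%:R :> R by rewrite ltr0n; lia.
by move=> s0 sL; rewrite -(pmulr_rgt0 _ s0); apply: lt_trans sL.
Qed.

Let deg_gt1 x : (1 < deg inc x)%N.
Proof.
have := deg_point wL joint_gt0 x.
have := deg_gt0 joint_gt0 x; rewrite leq_eqVlt => /orP[/eqP<-|//].
by move: L_lt1; lra.
Qed.

Let c x := (s%:R - 1) * (s.+1%:R * L - 1) - ((deg inc x)%:R - s%:R) * (1 - L).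
Let d := (s%:R * L - 1) * (s.+1%:R * L - 1).

Let chord x : w x * c x <= d /\ (w x * c x = d ->
  [/\ 0 < w x, deg inc x = s \/ deg inc x = s.+1
    & ((deg inc x)%:R - 1) * w x = (deg inc x)%:R * L - 1]).
Proof.
have [w0 _ _] := wL; apply: chord_bound => //.
- by rewrite L_gt0.
- exact: load_gt_inv.
- exact: deg_point.
Qed.

(** An exact identity: the quadratic is the sum of the chord slacks and a multiple of the slack in
    [sum_deg_le]. Its vanishing makes every estimate tight. *)
Lemma load_poly_sum : load_poly m s L =
  \sum_x (d - w x * c x) + (1 - L) * (m%:R * L - \sum_x (deg inc x)%:R * w x).
Proof.
have [_ w1 _] := wL.
have -> : \sum_x (d - w x * c x) = m%:R * d
    - ((s%:R - 1) * (s.+1%:R * L - 1) + s%:R * (1 - L)) * \sum_x w x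
    + (1 - L) * \sum_x (deg inc x)%:R * w x.
  rewrite !mulr_sumr -sumrN.
  have -> : m%:R * d = \sum_(x < m) d by rewrite sumr_const card_ord mulr_natl.
  by rewrite -!big_split /=; apply: eq_bigr => x _; rewrite /c; ring.
by rewrite w1 /load_poly /d -natr1; ring.
Qed.

Lemma load_poly_ge0 : 0 <= load_poly m s L.
Proof.
rewrite load_poly_sum addr_ge0 //.
  by apply: sumr_ge0 => x _; rewrite subr_ge0; case: (chord x).
by rewrite mulr_ge0 // subr_ge0 ?(ltW L_lt1) //; exact: sum_deg_le.
Qed.

Lemma load_poly_eq0 : (s ^ 2 - s + 1 < m)%N -> load_poly m s L = 0 -> m = 4%N.
Proof.
move=> m_gt /eqP; have [w0 w1 bL] := wL.
have s0 : 0 <= \sum_x (d - w x * c x).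
  by apply: sumr_ge0 => x _; rewrite subr_ge0; case: (chord x).
rewrite load_poly_sum paddr_eq0 //; last first.
  by rewrite mulr_ge0 // subr_ge0 ?(ltW L_lt1) //; exact: sum_deg_le.
case/andP => /eqP sd _.
have tight x : w x * c x = d.
  apply/esym/eqP; rewrite -subr_eq0; apply/eqP.
  apply: (psumr_eq0P _ sd) => // y _.
  by rewrite subr_ge0; case: (chord y).
have wgt0 x : 0 < w x by have [_ /(_ (tight x))[]] := chord x.
have degs x : deg inc x = s \/ deg inc x = s.+1.
  by have [_ /(_ (tight x))[]] := chord x.
have dw x : ((deg inc x)%:R - 1) * w x = (deg inc x)%:R * L - 1.
  by have [_ /(_ (tight x))[]] := chord x.
have joint1 x y : x != y -> joint inc x y = 1%N.
  move=> xy; have := deg_load wL x; rewrite dw.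
  set S := \sum_(_ | _) _ => hS.
  have t0 z : z != x -> 0 <= ((joint inc x z)%:R - 1) * w z.
    by move=> _; rewrite mulr_ge0 // subr_ge0 ler1n joint_gt0.
  (* Equality in [deg_point] leaves no room for the excess sum. *)
  have S0 : S = 0.
    by apply/eqP; rewrite eq_le; apply/andP; split; [lra|exact: sumr_ge0].
  have yx : y != x by rewrite eq_sym.
  have /eqP := psumr_eq0P t0 S0 yx.
  rewrite mulf_eq0 (gt_eqF (wgt0 y)) orbF subr_eq0 -[1]/(1%:R) eqr_nat.
  by move/eqP.
(* A block with all points would have load 1 > L. *)
have bsize_lt j : (bsize inc j < m)%N.
  rewrite ltn_neqAle -[X in (_ <= X)%N](card_ord m) max_card andbT.
  apply/negP => /eqP hj.
  have := bL j; rewrite (eq_bigl xpredT) ?w1 ?leNgt ?L_lt1 // => x.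
  have /subset_cardP : #|[pred x | inc x j]| = #|'I_m| by rewrite card_ord.
  by move=> /(_ (subset_predT _)) /(_ x); rewrite !inE.
have ms : (s.+1 < m)%N by move: m_gt s_gt1; rewrite -mulnn; nia.
have deg_lt x : (deg inc x < m)%N by case: (degs x) => ->; lia.
have m0 : (0 < m)%N by lia.
(* The range of [m] excludes s^2 - s + 1 and s^2 + s + 1; m = 2s survives only for s = 2. *)
move: m_gt m_lt s_gt1; rewrite -mulnn.
by case: (linear_space_card joint1 bsize_lt deg_lt m0 degs); rewrite -?mulnn; nia.
Qed.

End Quadratic.

(** * The bound as the larger root of the quadratic *)

Definition load_bound (R : rcfType) (m s : nat) : R :=
  (s%:R ^+ 2 + (2 * m%:R - 1) * s%:R - 1
   + Num.sqrt ((s%:R ^+ 2 - s%:R - 1) ^+ 2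
               + 4 * m%:R * (s%:R - 1) * (s%:R ^+ 2 + s%:R + 1 - m%:R)))
  / (2 * m%:R * (s%:R ^+ 2 + s%:R - 1)).

(** The discriminant is a perfect square here. For m = 3, s = 1 its root changes sign, since s^2 - s
    - 1 < 0. *)
Lemma load_bound_large (R : rcfType) (m s : nat) : (0 < s)%N ->
  m = (s ^ 2 + s)%N \/ (m = (s ^ 2 + s + 1)%N /\ m <> 3%N) ->
  load_bound R m s = s.+1%:R / m%:R.
Proof.
move=> s0 hm; have q1 : 1 <= s%:R :> R by rewrite ler1n.
have t0 : 0 < s%:R ^+ 2 + s%:R - 1 :> R by nra.
have mE : m%:R = s%:R ^+ 2 + s%:R :> R \/
    (m%:R = s%:R ^+ 2 + s%:R + 1 :> R /\ 2 <= s%:R :> R).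
  case: hm => [->|[mE m3]]; [left|right]; first by rewrite natrD natrX.
  split; first by rewrite mE !natrD natrX.
  by rewrite ler_nat; case: s s0 mE {q1 t0} => [|[|s]] // _ /m3.
have m0 : 0 < m%:R :> R by case: mE => [|[]] ->; nra.
have sq : Num.sqrt ((s%:R ^+ 2 - s%:R - 1) ^+ 2
    + 4 * m%:R * (s%:R - 1) * (s%:R ^+ 2 + s%:R + 1 - m%:R)) =
    2 * s.+1%:R * (s%:R ^+ 2 + s%:R - 1)
      - (s%:R ^+ 2 + (2 * m%:R - 1) * s%:R - 1) :> R.
  rewrite -natr1; case: mE => [->|[-> q2]].
    rewrite (_ : (_ + _ * _) = (s%:R ^+ 2 + s%:R - 1) ^+ 2); last by ring.
    by rewrite sqrtr_sqr gtr0_norm //; ring.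
  rewrite (_ : (_ + _ * _) = (s%:R ^+ 2 - s%:R - 1) ^+ 2); last by ring.
  by rewrite sqrtr_sqr ger0_norm; [ring|nra].
rewrite /load_bound sq -natr1; field; rewrite !lt0r_neq0 //.
Qed.

Section Root.
Context (R : rcfType) (m s : nat).
Hypotheses (s_gt1 : (1 < s)%N) (m_gt : (s ^ 2 - s + 1 < m)%N)
  (m_lt : (m < s ^ 2 + s)%N).

Let q : R := s%:R.
Let p : R := m%:R.
Let t : R := q ^+ 2 + q - 1.
Let X : R := q ^+ 2 + (2 * p - 1) * q - 1.
Let D : R := (q ^+ 2 - q - 1) ^+ 2 + 4 * p * (q - 1) * (q ^+ 2 + q + 1 - p).

Let q2 : 2 <= q. Proof. by rewrite ler_nat. Qed.
Let p1 : 2 <= p. Proof. by rewrite ler_nat; move: m_gt; lia. Qed.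
Let pq : p <= q ^+ 2 + q - 1.
Proof. by rewrite lerBrDr /p /q -natrX natr1 -natrD ler_nat. Qed.
Let t0 : 0 < t. Proof. by rewrite /t; move: q2; nra. Qed.
Let den0 : 0 < 2 * p * t.
Proof. by rewrite !mulr_gt0 //; move: p1; lra. Qed.
Let num0 : 0 < 4 * p * t. Proof. by have := den0; lra. Qed.

Let discE L : (2 * p * t * L - X) ^+ 2 - D = 4 * p * t * load_poly m s L.
Proof. by rewrite /load_poly /X /D /t -/p -/q; ring. Qed.

(** Places 1/s strictly between the two roots, so a load above 1/s with nonnegative [load_poly] is
    at least the larger root. *)
Let poly_inv : load_poly m s q^-1 < 0.
Proof.
have q0 : q != 0 by rewrite gt_eqF //; move: q2; lra.
have -> : load_poly m s q^-1 = (q - 1) * (p - q * (q + 1)) / q ^+ 2.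
  by rewrite /load_poly -/p -/q; field.
rewrite pmulr_llt0 ?invr_gt0 ?exprn_gt0 //; last by move: q2; lra.
by rewrite pmulr_rlt0; move: pq q2; [nra|lra].
Qed.

Let disc_gt0 : 0 < D.
Proof.
have := discE q^-1; have : 4 * p * t * load_poly m s q^-1 < 0.
  by rewrite pmulr_rlt0.
by have := sqr_ge0 (2 * p * t * q^-1 - X); lra.
Qed.

Lemma load_poly_root : load_poly m s (load_bound R m s) = 0.
Proof.
have E : 2 * p * t * load_bound R m s - X = Num.sqrt D.
  by rewrite /load_bound -/p -/q -/t -/D -/X mulrC divfK ?gt_eqF //; ring.
have := discE (load_bound R m s); rewrite E sqr_sqrtr ?ltW // subrr => /esym/eqP.
by rewrite mulf_eq0 gt_eqF // => /eqP.
Qed.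

(** The point 1 lies to the right of the vertex ([x0]), and the quadratic is positive there. *)
Lemma load_bound_lt1 : load_bound R m s < 1.
Proof.
rewrite /load_bound -/p -/q -/t -/D -/X ltr_pdivrMr // mul1r -ltrBrDl.
have x0 : 0 < 2 * p * t - X.
  have h : 0 <= (p - 2) * (q ^+ 2 - 1).
    by move: q2 p1 => *; apply: mulr_ge0; [lra|nra].
  by rewrite /X /t; move: q2 h; nra.
rewrite -(gtr0_norm x0) -sqrtr_sqr ltr_sqrt ?exprn_gt0 // -subr_gt0.
have := discE 1; rewrite mulr1 => ->.
rewrite mulr_gt0 //.
have -> : load_poly m s 1 = (p - 1) * (q ^+ 2 - q) by rewrite /load_poly -/p -/q; ring.
by move: q2 p1 => *; apply: mulr_gt0; [lra|nra].
Qed.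

Lemma load_bound_le L : 1 < q * L -> 0 <= load_poly m s L -> load_bound R m s <= L.
Proof.
move=> qL fL.
have q0 : 0 < q by move: q2; lra.
rewrite /load_bound -/p -/q -/t -/D -/X ler_pdivrMr // -lerBrDl.
have sD : Num.sqrt D <= `|2 * p * t * L - X|.
  by rewrite -sqrtr_sqr ler_wsqrtr // -subr_ge0 discE mulr_ge0 // ltW.
have sD' : `|2 * p * t * q^-1 - X| < Num.sqrt D.
  by rewrite -sqrtr_sqr ltr_sqrt // -subr_lt0 discE pmulr_rlt0.
have Lq : 2 * p * t * q^-1 < 2 * p * t * L.
  by rewrite ltr_pM2l // -[q^-1]mul1r ltr_pdivrMr // mulrC.
move: sD; rewrite ler_normr => /orP[|h]; first by rewrite [L * _]mulrC.
by move: sD'; rewrite ltr_norml => /andP[h' _]; lra.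
Qed.

End Root.

(** * The lower bound for one incidence relation *)

Section Incidence.
Context (R : realType) (m s : nat) (inc : 'I_m -> 'I_m -> bool).
Hypothesis joint_gt0 : forall x y, (0 < joint inc x y)%N.
Hypotheses (s_gt0 : (0 < s)%N) (hsm : (s ^ 2 - s + 1 < m <= s ^ 2 + s + 1)%N).

Lemma feasible_load_small (w : 'I_m -> R) (L : R) : (m < s ^ 2 + s)%N ->
  feasible inc w L -> load_bound R m s <= L /\ (L = load_bound R m s -> m = 4%N).
Proof.
move=> m_lt wL; have /andP[m_gt _] := hsm.
have s_gt1 : (1 < s)%N by case: s s_gt0 m_gt m_lt => [|[|]] //; lia.
have b1 := load_bound_lt1 R s_gt1 m_gt m_lt.
have [L1|L1] := leP 1 L.
  have bL := lt_le_trans b1 L1; split; first exact: ltW.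
  by move=> Lb; move: bL; rewrite Lb ltxx.
split.
  apply: load_bound_le => //; first exact: load_gt_inv wL joint_gt0 s_gt1 m_lt.
  exact: load_poly_ge0 wL joint_gt0 s_gt1 m_lt L1.
move=> Lb; apply: (load_poly_eq0 wL joint_gt0 s_gt1 m_lt L1 m_gt).
by rewrite Lb load_poly_root.
Qed.

(** If m L < s + 1, then s (s + 1) <= m gives s L < 1, against [load_small]. *)
Lemma feasible_load_large (w : 'I_m -> R) (L : R) : m <> 3%N ->
  (s ^ 2 + s <= m)%N -> feasible inc w L -> load_bound R m s <= L.
Proof.
move=> m3 m_ge wL; have /andP[m_gt m_le] := hsm.
rewrite load_bound_large //; last first.
  by move: m_ge; rewrite leq_eqVlt => /orP[/eqP->|?]; [left|right; split => //; lia].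
have m0 : 0 < m%:R :> R by rewrite ltr0n; lia.
rewrite ler_pdivrMr // mulrC leNgt; apply/negP => Lm.
have : s%:R * L < 1.
  have := m_ge; rewrite -mulnn -mulnSr => sm.
  have {}sm : s%:R * s.+1%:R <= m%:R :> R by rewrite -natrM ler_nat.
  have q0 : 0 < s%:R :> R by rewrite ltr0n.
  have h : m%:R * (s%:R * L) < m%:R * 1.
    rewrite mulr1 mulrCA; apply: lt_le_trans sm.
    by rewrite ltr_pM2l.
  by rewrite ltr_pM2l in h.
by move/(load_small wL joint_gt0); rewrite leNgt Lm.
Qed.

Lemma feasible_load (w : 'I_m -> R) (L : R) : m <> 3%N ->
  feasible inc w L -> load_bound R m s <= L.
Proof.
move=> m3 wL; have [m_ge|m_lt] := leqP (s ^ 2 + s) m.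
  exact: feasible_load_large m3 m_ge wL.
by have [] := feasible_load_small m_lt wL.
Qed.

End Incidence.

(** * Attained minima and the strict gap *)

Section Gap.
Local Open Scope classical_set_scope.

Lemma min_load (R : realType) (m : nat) (inc : 'I_m -> 'I_m -> bool) :
  (0 < m)%N -> exists (w0 : 'I_m -> R) (L0 : R),
    feasible inc w0 L0 /\ forall w L, feasible inc w L -> L0 <= L.
Proof.
move=> m0.
(* The default 0 is harmless, as loads on the simplex are nonnegative. *)
pose load (v : 'rV[R]_m) : R := \big[Num.max/0]_j \sum_(x | inc x j) v ord0 x.
pose simplex : set 'rV[R]_m :=
  [set v | forall i, `[0, 1] (v ord0 i)] `&` [set v | \sum_i v ord0 i = 1].
have csum (P : pred 'I_m) : continuous (fun v : 'rV[R]_m => \sum_(i | P i) v ord0 i).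
  apply: continuous_big; first exact: add_continuous.
  by move=> i _; exact: coord_continuous.
have cload : continuous load.
  by apply: continuous_big; [exact: max_continuous|move=> j _; exact: csum].
have cS : compact simplex.
  apply: compact_closedI.
    apply: (@rV_compact R m (fun=> `[0, 1]%classic)) => i.
    exact: segment_compact.
  apply: (@preimage_closed _ _ (fun v : 'rV[R]_m => \sum_i v ord0 i)
    [set x | x = 1]); last exact: closed_eq.
  by move=> v _; exact: csum.
have S0 : simplex !=set0.
  exists (\row_i (i == Ordinal m0)%:R); split.
    by move=> i /=; rewrite mxE in_itv /= ler0n lern1 leq_b1.
  rewrite /= (bigD1 (Ordinal m0)) //= mxE eqxx big1 ?addr0 // => i /negPf h.
  by rewrite mxE h.
have [v vS vmin] := EVT_min_rV S0 cS (continuous_subspaceT cload).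
exists (v ord0), (load v); split.
  move: vS; rewrite inE => -[v01 v1]; split => //.
    by move=> x; have := v01 x; rewrite /= in_itv => /andP[].
  by move=> j; rewrite /load; apply: (le_bigmax _ (fun j => \sum_(x | inc x j) v ord0 x)).
move=> w L [w0 w1 wL].
pose u : 'rV[R]_m := \row_i w i.
have uS : simplex u.
  split; last by rewrite /= -[RHS]w1; apply: eq_bigr => i _; rewrite mxE.
  move=> i; rewrite /= mxE in_itv /= w0 /= -w1 (bigD1 i) //= lerDl.
  exact: sumr_ge0.
apply: le_trans (vmin u _) _; first by rewrite inE.
apply: bigmax_le => [|j _].
  by apply: le_trans (wL (Ordinal m0)); exact: sumr_ge0.
by apply: le_trans (wL j); apply: ler_sum => x _; rewrite mxE.
Qed.

(* There are finitely many incidence relations, so the strict inequality for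
   each of them separates the infimum from the bound. *)
Lemma load_gap (R : realType) (m s : nat) : (0 < s)%N ->
  (s ^ 2 - s + 1 < m < s ^ 2 + s)%N -> m <> 4%N ->
  exists2 c : R, load_bound R m s < c &
    forall (inc : 'I_m -> 'I_m -> bool) w L,
      (forall x y, (0 < joint inc x y)%N) -> feasible inc w L -> c <= L.
Proof.
move=> s0 /andP[m_gt m_lt] m4; pose b := load_bound R m s.
have m0 : (0 < m)%N by lia.
have /choice[c hc] (g : {ffun 'I_m * 'I_m -> bool}) : exists c, b < c /\
    forall w L, (forall x y, 0 < joint (fun x j => g (x, j)) x y)%N ->
      feasible (fun x j => g (x, j)) w L -> c <= L.
  have [w0 [L0 [fL0 minL0]]] := @min_load R m (fun x j => g (x, j)) m0.
  have [jg|jg] := pselect (forall x y, 0 < joint (fun x j => g (x, j)) x y)%N.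
    exists L0; split; last by move=> w L _; exact: minL0.
    have sm : (s ^ 2 - s + 1 < m <= s ^ 2 + s + 1)%N by lia.
    have [bL Lb] := feasible_load_small jg s0 sm m_lt fL0.
    by rewrite lt_neqAle bL andbT; apply/eqP => /esym/Lb.
  (* Relations without the covering property get an arbitrary value above [b]. *)
  by exists (b + 1); split; [rewrite ltrDl|move=> w L /jg].
exists (\big[Num.min/b + 1]_g c g).
  by apply/bigmin_gtP; split => [|g _]; [rewrite ltrDl|case: (hc g)].
move=> inc w L j0 fL.
have incE : inc = fun x j => [ffun u : 'I_m * 'I_m => inc u.1 u.2] (x, j).
  by apply/funext => x; apply/funext => j; rewrite ffunE.
have [_ /(_ w L)] := hc [ffun u : 'I_m * 'I_m => inc u.1 u.2].
rewrite -incE => /(_ j0 fL); apply: le_trans; exact: bigmin_le_cond.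
Qed.

End Gap.

(** * From designs to incidence relations *)

Lemma design_feasible (R : realType) (D : covering_design) (w : points D -> R) :
  normalised w -> exists2 inc : 'I_(size (blocks D)) -> 'I_(size (blocks D)) -> bool,
    forall x y, (0 < joint inc x y)%N &
    exists w', feasible inc w' (L_weighted w).
Proof.
case=> w0 w1; set m := size (blocks D).
pose inc0 (x : points D) (j : 'I_m) := x \in nth finset.set0 (blocks D) j.
have cov2 x y : exists j, inc0 x j && inc0 y j.
  have cov x' y' : x' <> y' -> exists j, inc0 x' j && inc0 y' j.
    move/pair_covered => [B BD [xB yB]].
    have jm : (index B (blocks D) < m)%N by rewrite index_mem.
    by exists (Ordinal jm); rewrite /inc0 /= nth_index // xB.
  have [<-|/eqP/cov//] := eqVneq x y.
  (* Two indices may stand for the same point, so each point must share a block with itself; a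
     second point provides one. *)
  have [z zx] : exists z, z <> x.
    have /card_gt1P[a [b [_ _ ab]]] := points_gt1 D.
    have [ax|/eqP] := eqVneq a x; last by exists a.
    by exists b; apply/eqP; rewrite -ax eq_sym.
  by have [j /andP[_ xj]] := cov z x zx; exists j; rewrite xj.
have cov1 x : exists j, inc0 x j by have [j /andP[]] := cov2 x x; exists j.
have f0 : feasible_on inc0 (L_weighted w) #|points D|.
  exists enum_val, (w \o enum_val); split.
  - by move=> i; exact: w0.
  - rewrite -w1 /weight (reindex (@enum_val _ (points D))) /=; last first.
      exact/onW_bij/enum_val_bij.
    by apply: eq_bigl => i; rewrite finset.in_setT.
  - move=> j; rewrite /= (_ : \sum_(_ | _) _ = weight w (nth finset.set0 (blocks D) j)).
      by apply: le_bigmax_seq => //; rewrite mem_nth.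
    rewrite /weight [RHS](reindex (@enum_val _ (points D))) //=.
    exact/onW_bij/enum_val_bij.
have [f [w' fw']] := feasible_on_blocks cov1 f0.
exists (inc0 \o f); last by exists w'.
move=> x y; have [j hj] := cov2 (f x) (f y).
by apply/card_gt0P; exists j; rewrite inE.
Qed.

Lemma le_L_num (R : realType) (m : nat) (c : R) : (0 < m)%N ->
  (forall (inc : 'I_m -> 'I_m -> bool) w L,
    (forall x y, (0 < joint inc x y)%N) -> feasible inc w L -> c <= L) ->
  c <= L_num R m.
Proof.
move=> m0 hc; apply: lb_le_inf.
  (* The set of designs is nonempty: two points and [m] copies of the full block. *)
  have pc (x y : bool) : x <> y -> exists2 B,
      B \in msetn m (finset.setTfor bool) & x \in B /\ y \in B.
    move=> _; exists (finset.setTfor bool);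
      by rewrite ?in_msetn ?m0 ?eqxx ?finset.in_setT.
  have b2 : (1 < #|{: bool}|)%N by rewrite card_bool.
  exists (L_design R (CoveringDesign b2 pc)); exists (CoveringDesign b2 pc) => //.
  by rewrite /= enum_msetn size_nseq.
move=> _ [D Dm ->]; apply: lb_le_inf.
  have /card_gt1P[a _] := points_gt1 D.
  exists (L_weighted (fun x => (x == a)%:R)), (fun x => (x == a)%:R) => //.
  split; first by move=> x; rewrite ler0n.
  rewrite /weight (bigD1 a) ?finset.in_setT //= eqxx big1 ?addr0 // => x.
  by move=> /andP[_ /negPf->].
move=> _ [w nw <-]; have [inc j0 [w' fw']] := design_feasible nw.
by move: inc j0 w' fw'; rewrite Dm => inc j0 w'; exact: hc.
Qed.

Theorem theorem1p3 (R : realType) (m s : nat) (hm : (2 <= m)%N)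
    (hs : (0 < s)%N) (hsm : (s ^ 2 - s + 1 < m <= s ^ 2 + s + 1)%N) :
  let bound : R :=
    (s%:R ^+ 2 + (2 * m%:R - 1) * s%:R - 1
     + Num.sqrt ((s%:R ^+ 2 - s%:R - 1) ^+ 2
                 + 4 * m%:R * (s%:R - 1) * (s%:R ^+ 2 + s%:R + 1 - m%:R)))
    / (2 * m%:R * (s%:R ^+ 2 + s%:R - 1)) in
  (* For m = 3, s = 1 the formula equals 1, while L(3) <= 2/3 (three points,
     the three pairs, weights 1/3). *)
  (m <> 3%N -> bound <= L_num R m) /\
  (L_num R m = bound -> m = 4%N \/ m = (s ^ 2 + s)%N \/ m = (s ^ 2 + s + 1)%N).
Proof.
move=> bound; have m0 : (0 < m)%N by exact: ltnW.
split=> [m3|Lb].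
  by apply: le_L_num => // inc w L j0; exact: feasible_load.
have [|m4] := eqVneq m 4%N; first by left.
right; have [m_ge|m_lt] := leqP (s ^ 2 + s) m; first by lia.
have sm : (s ^ 2 - s + 1 < m < s ^ 2 + s)%N by case/andP: hsm => ->.
(* An infimum could reach the bound without any design doing so; the uniform gap rules this out. *)
have [c bc hc] := load_gap R hs sm (elimN eqP m4).
by have := lt_le_trans bc (le_L_num m0 hc); rewrite Lb ltxx.
Qed.
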